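(* The following identity of differential operators holds: $$\widetilde{\Box}=G\circ\left(\mathcal{L}-\frac14\right)\circ G^{-1}.$$
   Context: Write $z=x+iy\in\mathbb{C}\cong\mathbb{R}^2$, $\frac{d}{dz}=\frac12(\partial_x-i\partial_y)$, $\frac{d}{d\overline{z}}=\frac12(\partial_x+i\partial_y)$, $\Delta=\partial_x^2+\partial_y^2$. Here $$\widetilde{\Box}=-\frac{d^2}{dz\,d\overline{z}}-\frac{z}{2}\frac{d}{d\overline{z}}+\frac{\overline{z}}{2}\frac{d}{d\overline{z}},\qquad \mathcal{L}=-\frac14\Delta-\frac{iy}{2}\frac{\partial}{\partial x}+\frac{y^2}{4}.$$ Let $g(y)=\frac{e^{-y^2/2}}{\sqrt{2\pi}}$, $y\in\mathbb{R}$. The RBF-ground state transformation is $G:L^2(\mathbb{R}^2,dx\,dy)\to L^2(\mathbb{R}^2,g^2\,dx\,dy)$, $Gf=\frac{f}{g}$, with inverse $G^{-1}f=f\cdot g$. The identity is one between differential expressions, i.e. it holds when applied to (twice differentiable) functions on $\mathbb{R}^2$. *)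

(* Defs.v *)
(* Stdlib reals and Coquelicot. *)
From Stdlib Require Import Reals Lra.
From Coquelicot Require Import Coquelicot.

Open Scope C_scope.

(* Coquelicot's C is the product R * R, so that a function C -> C is at the
   same time a complex-valued function on R^2, with z = (x, y) = x + i y. *)

(* Derivative of a complex-valued function of one real variable. As with
   [Derive], the value is meaningful only where that derivative exists. *)
Definition derive_RC (h : R -> C) (t : R) : C :=
  (Derive (fun s => Re (h s)) t, Derive (fun s => Im (h s)) t).

Definition partial_x (f : C -> C) (z : C) : C :=
  derive_RC (fun t => f (t, Im z)) (Re z).

Definition partial_y (f : C -> C) (z : C) : C :=
  derive_RC (fun t => f (Re z, t)) (Im z).

(* Real (Frechet) differentiability of f : R^2 -> C, not holomorphy: the
   scalars are those of [C_R_NormedModule]. *)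
Definition differentiable (f : C -> C) : Prop :=
  forall z : C,
    @ex_filterdiff R_AbsRing C_R_NormedModule C_R_NormedModule f (locally z).

(* The Frechet derivative of f at z is u |-> Re u * partial_x f z
   + Im u * partial_y f z, so it is differentiable in z exactly when both
   partial derivatives are. *)
Definition twice_differentiable (f : C -> C) : Prop :=
  differentiable f /\
  differentiable (partial_x f) /\ differentiable (partial_y f).

Definition d_dz (f : C -> C) (z : C) : C :=
  / 2 * (partial_x f z - Ci * partial_y f z).

Definition d_dzbar (f : C -> C) (z : C) : C :=
  / 2 * (partial_x f z + Ci * partial_y f z).

Definition Laplacian (f : C -> C) (z : C) : C :=
  partial_x (partial_x f) z + partial_y (partial_y f) z.

Definition Box_tilde (f : C -> C) (z : C) : C :=
  - d_dz (d_dzbar f) z - z / 2 * d_dzbar f z + Cconj z / 2 * d_dzbar f z.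

Definition L_op (f : C -> C) (z : C) : C :=
  - (/ 4) * Laplacian f z - Ci * Im z / 2 * partial_x f z
  + (Im z) ^ 2 / 4 * f z.

Definition rbf_g (y : R) : R := (exp (- y ^ 2 / 2) / sqrt (2 * PI))%R.

(* The formulas for the RBF-ground state transformation and its inverse, on
   arbitrary functions rather than on classes in the weighted L^2 spaces. *)
Definition G (f : C -> C) (z : C) : C := f z / rbf_g (Im z).

Definition G_inv (f : C -> C) (z : C) : C := f z * rbf_g (Im z).

Definition minus_scalar (T : (C -> C) -> C -> C) (c : C) (f : C -> C) (z : C)
  : C := T f z - c * f z.

Lemma rbf_g_neq0 (y : R) : RtoC (rbf_g y) <> 0.
Proof.
intros H; apply RtoC_inj in H; revert H; apply Rgt_not_eq.
apply Rdiv_lt_0_compat; [apply exp_pos | apply sqrt_lt_R0].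
generalize PI_RGT_0; lra.
Qed.

Lemma G_invK (f : C -> C) (z : C) : G (G_inv f) z = f z.
Proof. unfold G, G_inv; field; apply rbf_g_neq0. Qed.

Lemma GK (f : C -> C) (z : C) : G_inv (G f) z = f z.
Proof. unfold G, G_inv; field; apply rbf_g_neq0. Qed.

(* Main.v *)
Require Import Defs.
From Stdlib Require Import Reals Basics Lra.
From Coquelicot Require Import Coquelicot.

(** In real coordinates [z - Cconj z = 2 * Ci * y], so the first-order part of
    [Box_tilde] is [- Ci * y * d_dzbar], that is
    [- Ci * y / 2 * partial_x + y / 2 * partial_y], and its second-order part
    is a quarter of [- Laplacian].

    On the other side, [rbf_g' = - y * rbf_g], so that for [h := f * rbf_g]
    one has [h_xx = f_xx * rbf_g] and
    [h_yy = (f_yy - 2 * y * f_y + (y ^ 2 - 1) * f) * rbf_g]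
    ([partial_xx_G_inv], [partial_yy_G_inv]). After division by [rbf_g], the
    term [y / 2 * f_y] produced by [- / 4 * h_yy] is the drift of [Box_tilde],
    [- y ^ 2 / 4 * f] cancels the potential of [L_op], and [/ 4 * f] cancels
    the shift by [/ 4].

    The one analytic point is the factorization
    [d_dz (d_dzbar f) = / 4 * Laplacian f]: expanding the left-hand side leaves
    the commutator of [partial_x] and [partial_y]. The second partial
    derivatives of [f] are not assumed continuous, so their symmetry has to
    come from Young's form of the theorem, in which it is enough that both
    first partial derivatives are differentiable at the point
    ([mixed_partials_eq]). *)

(** * Symmetry of second derivatives *)

Open Scope R_scope.

(** Applying the mean value theorem to [s => u s (y + h) - u s y] reduces the
    second difference to an increment of [ux], and the differentiability of
    [ux] at the point itself controls that increment: its [lxx] terms cancel.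
    Only one of the two mixed derivatives enters, while the second difference
    is symmetric in the two variables. *)
Lemma second_difference_bound (u ux : R -> R -> R) (x y lxx lxy : R) :
  (forall a b, is_derive (fun t => u t b) a (ux a b)) ->
  differentiable_pt_lim ux x y lxx lxy ->
  forall eps : posreal, exists delta : posreal, forall h, 0 < h < delta ->
    Rabs (u (x + h) (y + h) - u (x + h) y - u x (y + h) + u x y
          - lxy * h ^ 2) <= eps * h ^ 2.
Proof.
intros Hu Hux eps.
destruct (Hux (pos_div_2 eps)) as [delta Hdelta].
exists delta; intros h Hh.
destruct (MVT_gen (fun s => u s (y + h) - u s y) x (x + h)
            (fun s => ux s (y + h) - ux s y)) as [c [Hc Hmvt]].
- intros s _; apply (is_derive_minus (K := R_AbsRing) (V := R_NormedModule));
    apply Hu.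
- intros s _; apply continuity_pt_minus; apply derivable_continuous_pt;
    eexists; apply is_derive_Reals; apply Hu.
- rewrite Rmin_left, Rmax_right in Hc by lra.
  assert (Hup := Hdelta c (y + h)).
  assert (Hdn := Hdelta c y).
  replace (y + h - y) with h in Hup by ring.
  replace (y - y) with 0 in Hdn by ring.
  rewrite Rabs_R0 in Hdn.
  rewrite (Rabs_right (c - x)) in Hup, Hdn by lra.
  rewrite (Rabs_right h) in Hup by lra.
  rewrite Rmax_right in Hup by lra.
  rewrite Rmax_left in Hdn by lra.
  specialize (Hup ltac:(lra) ltac:(lra)).
  specialize (Hdn ltac:(lra) (cond_pos delta)).
  simpl in Hup, Hdn.
  replace (u (x + h) (y + h) - u (x + h) y - u x (y + h) + u x y - lxy * h ^ 2)
    with ((u (x + h) (y + h) - u (x + h) y - (u x (y + h) - u x y))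
          - lxy * h ^ 2) by ring.
  rewrite Hmvt.
  replace ((ux c (y + h) - ux c y) * (x + h - x) - lxy * h ^ 2)
    with ((ux c (y + h) - ux c y - lxy * h) * h) by ring.
  rewrite Rabs_mult, (Rabs_right h) by lra.
  replace (eps * h ^ 2) with (eps * h * h) by ring.
  apply Rmult_le_compat_r; [lra|].
  assert (Hcx : eps / 2 * (c - x) <= eps / 2 * h).
  { apply Rmult_le_compat_l; [generalize (cond_pos eps) |]; lra. }
  apply Rabs_le_between in Hup; apply Rabs_le_between in Hdn.
  apply Rabs_le_between; lra.
Qed.

(** Young's theorem: both mixed derivatives are the limit of the same second
    difference divided by [h ^ 2]. *)
Lemma mixed_partials_eq (u ux uy : R -> R -> R) (x y lxx lxy lyx lyy : R) :
  (forall a b, is_derive (fun t => u t b) a (ux a b)) ->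
  (forall a b, is_derive (fun t => u a t) b (uy a b)) ->
  differentiable_pt_lim ux x y lxx lxy ->
  differentiable_pt_lim uy x y lyx lyy ->
  lxy = lyx.
Proof.
intros Hux Huy Dux Duy.
apply cond_eq; intros eps Heps.
(* Two errors of [eps / 4] add up to less than [eps]. *)
set (e := pos_div_2 (pos_div_2 (mkposreal eps Heps))).
destruct (second_difference_bound u ux x y lxx lxy Hux Dux e) as [d1 H1].
assert (Duy' : differentiable_pt_lim (fun b a => uy a b) y x lyy lyx).
{ intros e'; destruct (Duy e') as [d Hd]; exists d; intros v w Hv Hw.
  rewrite Rmax_comm, (Rplus_comm (lyy * _)); apply Hd; assumption. }
destruct (second_difference_bound (fun b a => u a b) (fun b a => uy a b)
            y x lyy lyx (fun b a => Huy a b) Duy' e) as [d2 H2].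
set (h := Rmin d1 d2 / 2).
assert (Hmin : 0 < Rmin d1 d2).
{ apply Rmin_glb_lt; apply cond_pos. }
assert (Hl := Rmin_l d1 d2); assert (Hr := Rmin_r d1 d2).
assert (Hh : 0 < h) by (unfold h; lra).
specialize (H1 h ltac:(unfold h in *; lra)).
specialize (H2 h ltac:(unfold h in *; lra)).
apply Rabs_le_between in H1; apply Rabs_le_between in H2.
assert (Hh2 : 0 < h ^ 2) by (apply pow_lt; assumption).
apply Rle_lt_trans with (2 * e); [| simpl; lra].
apply (Rmult_le_reg_r (h ^ 2)); [assumption |].
rewrite <- (Rabs_right (h ^ 2)) at 1 by lra.
rewrite <- Rabs_mult; apply Rabs_le_between; lra.
Qed.

(** * Differentiation of complex-valued functions of a real variable *)

Open Scope C_scope.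

(** Componentwise rather than as one Frechet derivative, so that it determines
    the value of [derive_RC] and inherits the product rule of the reals. *)
Definition is_derive_RC (h : R -> C) (t : R) (l : C) : Prop :=
  is_derive (fun s => Re (h s)) t (Re l) /\
  is_derive (fun s => Im (h s)) t (Im l).

Lemma is_derive_RC_unique (h : R -> C) (t : R) (l : C) :
  is_derive_RC h t l -> derive_RC h t = l.
Proof.
intros [Hre Him]; apply injective_projections; apply is_derive_unique;
  assumption.
Qed.

Lemma derive_RC_ext (h k : R -> C) (t : R) :
  (forall s, h s = k s) -> derive_RC h t = derive_RC k t.
Proof.
intros E; unfold derive_RC; f_equal; apply Derive_ext; intros s; now rewrite E.
Qed.

Lemma is_derive_RC_const (c : C) (t : R) : is_derive_RC (fun _ => c) t 0.
Proof. split; apply @is_derive_const. Qed.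

Lemma is_derive_RC_RtoC (g : R -> R) (t l : R) :
  is_derive g t l -> is_derive_RC (fun s => RtoC (g s)) t l.
Proof. intros Hg; split; [exact Hg | exact (is_derive_const 0%R t)]. Qed.

Lemma is_derive_RC_plus (h k : R -> C) (t : R) (lh lk : C) :
  is_derive_RC h t lh -> is_derive_RC k t lk ->
  is_derive_RC (fun s => h s + k s) t (lh + lk).
Proof.
intros [Hre Him] [Kre Kim].
split; [exact (is_derive_plus _ _ _ _ _ Hre Kre)
       | exact (is_derive_plus _ _ _ _ _ Him Kim)].
Qed.

Lemma is_derive_RC_mult (h k : R -> C) (t : R) (lh lk : C) :
  is_derive_RC h t lh -> is_derive_RC k t lk ->
  is_derive_RC (fun s => h s * k s) t (lh * k t + h t * lk).
Proof.
intros [Hre Him] [Kre Kim].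
assert (M : forall (a b : R -> R) (la lb : R),
  is_derive a t la -> is_derive b t lb ->
  is_derive (fun s => a s * b s)%R t (la * b t + a t * lb)%R).
{ intros a b la lb Ha Hb.
  exact (is_derive_mult a b t la lb Ha Hb Rmult_comm). }
split; unfold Re, Im in *; simpl.
- evar_last.
  + apply @is_derive_minus; apply M; eassumption.
  + unfold minus, plus, opp; simpl; ring.
- evar_last.
  + apply @is_derive_plus; apply M; eassumption.
  + unfold plus; simpl; ring.
Qed.

(** * Partial derivatives of a real-differentiable function *)

(** The projection [p] stands for [Re] or [Im]: composing with a real-linear
    form reduces the complex-valued derivative to a real-valued one, whose two
    coefficients are then the partial derivatives. *)
Lemma differentiable_component (f : C -> C) (p : C -> R) :
  @is_linear R_AbsRing C_R_NormedModule R_NormedModule p ->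
  differentiable f -> forall z : C,
  differentiable_pt_lim (fun a b => p (f (a, b))) (Re z) (Im z)
    (Derive (fun t => p (f (t, Im z))) (Re z))
    (Derive (fun t => p (f (Re z, t))) (Im z)).
Proof.
intros Hp Hf z.
destruct (Hf z) as [l Hl].
assert (Hpf := @filterdiff_comp' _ C_R_NormedModule C_R_NormedModule
  R_NormedModule f p z l p Hl (filterdiff_linear _ Hp)).
destruct Hpf as [Hlin Hd].
assert (E : forall w : C,
  p (l w) = (fst w * p (l (1, 0)%R) + snd w * p (l (0, 1)%R))%R).
{ intros [a b].
  assert (Eab : (a, b) =
    @plus C_R_NormedModule (scal a (1, 0)%R) (scal b (0, 1)%R)).
  { unfold plus, scal; simpl; unfold prod_plus, prod_scal; simpl.
    unfold plus, scal; simpl; unfold mult; simpl; f_equal; ring. }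
  etransitivity; [exact (f_equal (fun w => p (l w)) Eab) |].
  etransitivity; [exact (linear_plus _ Hlin _ _) |].
  exact (f_equal2 Rplus (linear_scal _ Hlin _ _) (linear_scal _ Hlin _ _)). }
assert (D : differentiable_pt_lim (fun a b => p (f (a, b))) (Re z) (Im z)
              (p (l (1, 0)%R)) (p (l (0, 1)%R))).
{ apply filterdiff_differentiable_pt_lim.
  apply filterdiff_ext_lin with (fun w => p (l w)); [| exact E].
  destruct z as [x y].
  apply filterdiff_ext with (fun w => p (f w)); [intros [a b]; reflexivity |].
  split; assumption. }
destruct (differentiable_pt_lim_unique _ _ _ _ _ D) as [Ex Ey].
unfold Re, Im in *.
rewrite Ex, Ey; exact D.
Qed.

Lemma differentiable_pt_lim_is_derive (u : R -> R -> R) (x y lx ly : R) :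
  differentiable_pt_lim u x y lx ly ->
  is_derive (fun t => u t y) x lx /\ is_derive (fun t => u x t) y ly.
Proof.
intros D; split; apply is_derive_Reals.
- replace lx with (lx * 1 + ly * 0)%R by ring.
  apply (derivable_pt_lim_comp_2d u (fun t => t) (fun _ => y)); auto.
  + apply derivable_pt_lim_id.
  + apply derivable_pt_lim_const.
- replace ly with (lx * 0 + ly * 1)%R by ring.
  apply (derivable_pt_lim_comp_2d u (fun _ => x) (fun t => t)); auto.
  + apply derivable_pt_lim_const.
  + apply derivable_pt_lim_id.
Qed.

Lemma is_linear_Re : @is_linear R_AbsRing C_R_NormedModule R_NormedModule Re.
Proof. exact is_linear_fst. Qed.

Lemma is_linear_Im : @is_linear R_AbsRing C_R_NormedModule R_NormedModule Im.
Proof. exact is_linear_snd. Qed.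

Lemma differentiable_partials (f : C -> C) (x y : R) :
  differentiable f ->
  is_derive_RC (fun t => f (t, y)) x (partial_x f (x, y)) /\
  is_derive_RC (fun t => f (x, t)) y (partial_y f (x, y)).
Proof.
intros Hf.
destruct (differentiable_pt_lim_is_derive _ _ _ _ _
  (differentiable_component f Re is_linear_Re Hf (x, y))).
destruct (differentiable_pt_lim_is_derive _ _ _ _ _
  (differentiable_component f Im is_linear_Im Hf (x, y))).
split; split; assumption.
Qed.

(** Young's theorem is about real-valued functions, so it is applied to the
    components [Re (f z)] and [Im (f z)] separately. *)
Lemma partials_comm (f : C -> C) (z : C) :
  twice_differentiable f ->
  partial_x (partial_y f) z = partial_y (partial_x f) z.
Proof.
intros [Hf [Hfx Hfy]].
assert (Hcomp : forall p : C -> R,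
  @is_linear R_AbsRing C_R_NormedModule R_NormedModule p ->
  (forall x y, is_derive (fun t => p (f (t, y))) x (p (partial_x f (x, y)))) ->
  (forall x y, is_derive (fun t => p (f (x, t))) y (p (partial_y f (x, y)))) ->
  Derive (fun t => p (partial_y f (t, Im z))) (Re z) =
  Derive (fun t => p (partial_x f (Re z, t))) (Im z)).
{ intros p Hp Hx Hy; symmetry.
  exact (mixed_partials_eq (fun x y => p (f (x, y))) _ _ _ _ _ _ _ _ Hx Hy
           (differentiable_component _ p Hp Hfx z)
           (differentiable_component _ p Hp Hfy z)). }
apply injective_projections.
- apply (Hcomp Re is_linear_Re); intros x y;
    apply (differentiable_partials f x y Hf).
- apply (Hcomp Im is_linear_Im); intros x y;
    apply (differentiable_partials f x y Hf).
Qed.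

(** * Factorization of the Laplacian *)

Lemma partial_x_d_dzbar (f : C -> C) (z : C) :
  twice_differentiable f ->
  partial_x (d_dzbar f) z =
  / 2 * (partial_x (partial_x f) z + Ci * partial_x (partial_y f) z).
Proof.
intros [_ [Hfx Hfy]]; destruct z as [x y].
destruct (differentiable_partials _ x y Hfx) as [Dxx _].
destruct (differentiable_partials _ x y Hfy) as [Dyx _].
apply is_derive_RC_unique; unfold d_dzbar; simpl.
evar_last.
- apply is_derive_RC_mult; [apply is_derive_RC_const |].
  apply is_derive_RC_plus; [exact Dxx |].
  apply is_derive_RC_mult; [apply is_derive_RC_const | exact Dyx].
- cbv beta; ring.
Qed.

Lemma partial_y_d_dzbar (f : C -> C) (z : C) :
  twice_differentiable f ->
  partial_y (d_dzbar f) z =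
  / 2 * (partial_y (partial_x f) z + Ci * partial_y (partial_y f) z).
Proof.
intros [_ [Hfx Hfy]]; destruct z as [x y].
destruct (differentiable_partials _ x y Hfx) as [_ Dxy].
destruct (differentiable_partials _ x y Hfy) as [_ Dyy].
apply is_derive_RC_unique; unfold d_dzbar; simpl.
evar_last.
- apply is_derive_RC_mult; [apply is_derive_RC_const |].
  apply is_derive_RC_plus; [exact Dxy |].
  apply is_derive_RC_mult; [apply is_derive_RC_const | exact Dyy].
- cbv beta; ring.
Qed.

Lemma Ci_sqr : Ci * Ci = - (1).
Proof. unfold Ci, Cmult, Copp, RtoC; simpl; f_equal; ring. Qed.

(** The cross terms are [Ci / 4] times the commutator of [partial_x] and
    [partial_y], which vanishes by [partials_comm]. *)
Lemma d_dz_d_dzbar (f : C -> C) (z : C) :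
  twice_differentiable f -> d_dz (d_dzbar f) z = / 4 * Laplacian f z.
Proof.
intros Hf; unfold d_dz, Laplacian.
rewrite partial_x_d_dzbar, partial_y_d_dzbar, partials_comm by assumption.
set (a := partial_x (partial_x f) z); set (b := partial_y (partial_x f) z);
  set (c := partial_y (partial_y f) z).
transitivity (/ 4 * (a - Ci * Ci * c)); [field |].
rewrite Ci_sqr; ring.
Qed.

Lemma Ci_d_dzbar (f : C -> C) (z : C) :
  Ci * d_dzbar f z = / 2 * (Ci * partial_x f z - partial_y f z).
Proof.
unfold d_dzbar; set (a := partial_x f z); set (b := partial_y f z).
transitivity (/ 2 * (Ci * a + Ci * Ci * b)); [ring |].
rewrite Ci_sqr; ring.
Qed.

Lemma minus_Cconj (z : C) : z - Cconj z = 2 * Ci * Im z.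
Proof.
destruct z as [x y]; unfold Cminus, Cplus, Copp, Cconj, Cmult, Ci, RtoC; simpl.
f_equal; ring.
Qed.

(** * Conjugation by the Gaussian *)

Lemma is_derive_rbf_g (y : R) : is_derive rbf_g y (- y * rbf_g y)%R.
Proof.
unfold rbf_g; auto_derive; [trivial |].
replace (- (y * (y * 1)) * / 2)%R with (- y ^ 2 / 2)%R by (simpl; field).
unfold Rdiv; generalize (/ sqrt (2 * PI))%R; intros c; field.
Qed.

Lemma partial_x_G_inv (f : C -> C) (z : C) :
  differentiable f -> partial_x (G_inv f) z = G_inv (partial_x f) z.
Proof.
intros Hf; destruct z as [x y].
destruct (differentiable_partials f x y Hf) as [Dx _].
apply is_derive_RC_unique; unfold G_inv; simpl.
evar_last.
- apply is_derive_RC_mult; [exact Dx | apply is_derive_RC_const].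
- cbv beta; simpl Im; ring.
Qed.

Lemma partial_y_G_inv (f : C -> C) (z : C) :
  differentiable f ->
  partial_y (G_inv f) z = G_inv (fun w => partial_y f w - Im w * f w) z.
Proof.
intros Hf; destruct z as [x y].
destruct (differentiable_partials f x y Hf) as [_ Dy].
apply is_derive_RC_unique; unfold G_inv; simpl.
evar_last.
- apply is_derive_RC_mult; [exact Dy |].
  apply is_derive_RC_RtoC, is_derive_rbf_g.
- rewrite RtoC_mult, RtoC_opp; cbv beta; simpl Im; ring.
Qed.

Lemma partial_xx_G_inv (f : C -> C) (z : C) :
  twice_differentiable f ->
  partial_x (partial_x (G_inv f)) z = G_inv (partial_x (partial_x f)) z.
Proof.
intros [Hf [Hfx _]]; rewrite <- (partial_x_G_inv _ _ Hfx).
apply derive_RC_ext; intros s; now apply partial_x_G_inv.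
Qed.

(** [G_inv] turns [partial_y - y] into [partial_y], so [partial_yy] comes from
    the square of [partial_y - y]; its constant [- 1] is the derivative of
    the coefficient [- y]. *)
Lemma partial_yy_G_inv (f : C -> C) (z : C) :
  twice_differentiable f ->
  partial_y (partial_y (G_inv f)) z =
  G_inv (fun w => partial_y (partial_y f) w - 2 * Im w * partial_y f w
                  + ((Im w) ^ 2 - 1) * f w) z.
Proof.
intros [Hf [_ Hfy]].
transitivity
  (partial_y (G_inv (fun w => partial_y f w + RtoC (- Im w) * f w)) z).
{ apply derive_RC_ext; intros s; rewrite partial_y_G_inv by assumption.
  unfold G_inv; rewrite RtoC_opp; ring. }
destruct z as [x y].
destruct (differentiable_partials f x y Hf) as [_ Dy].
destruct (differentiable_partials _ x y Hfy) as [_ Dyy].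
apply is_derive_RC_unique; unfold G_inv; simpl.
evar_last.
- apply is_derive_RC_mult; [| apply is_derive_RC_RtoC, is_derive_rbf_g].
  apply is_derive_RC_plus; [exact Dyy |].
  apply is_derive_RC_mult; [| exact Dy].
  apply is_derive_RC_RtoC.
  apply (is_derive_opp (fun t : R => t)), is_derive_id.
- unfold opp, one; simpl.
  rewrite RtoC_mult, !RtoC_opp; cbv beta; simpl Im; ring.
Qed.

Theorem theorem5p15 :
  forall f : C -> C, twice_differentiable f ->
  forall z : C,
    Box_tilde f z =
    compose G (compose (minus_scalar L_op (/ 4)%C) G_inv) f z.
Proof.
intros f Hf z.
unfold compose, G, minus_scalar, Box_tilde, L_op.
rewrite d_dz_d_dzbar by assumption.
transitivity (- (/ 4 * Laplacian f z) + - Im z * (Ci * d_dzbar f z)).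
{ set (d := d_dzbar f z).
  transitivity (- (/ 4 * Laplacian f z) - (z - Cconj z) / 2 * d); [field |].
  rewrite minus_Cconj; field. }
rewrite Ci_d_dzbar; unfold Laplacian.
rewrite partial_xx_G_inv, partial_yy_G_inv by assumption.
rewrite (partial_x_G_inv f z (proj1 Hf)).
unfold G_inv.
assert (Hg := rbf_g_neq0 (Im z)).
field; auto.
Qed.
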